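(* Let $\mathbb{G}$ be a small groupoid. The group of extended inner automorphisms of $\mathbb{G}$ in the category $\mathrm{Grpd}_{\mathrm{co}}$ of small groupoids and comorphisms is isomorphic to the group $\mathrm{Bis}(\mathbb{G})$ of bisections of $\mathbb{G}$. Under this isomorphism, the extended inner automorphism corresponding to $\alpha \in \mathrm{Bis}(\mathbb{G})$ is the family of automorphisms $\bigl((c_{f\alpha})_\ast \colon \mathbb{H} \rightsquigarrow \mathbb{H}\bigr)$ as $f$ ranges over all comorphisms $f \colon \mathbb{G} \rightsquigarrow \mathbb{H}$.
   Context: Write $\mathbb{G}_0$ for the set of objects of a groupoid $\mathbb{G}$. Extended inner automorphisms. An extended inner automorphism of an object $G$ of a category $\mathcal{C}$ is a family of automorphisms $(\beta_f \colon H \to H)$, one for each map $f \colon G \to H$ of $\mathcal{C}$, such that $g \circ \beta_f = \beta_{gf} \circ g$ for all $f \colon G \to H$ and $g \colon H \to K$ in $\mathcal{C}$. They form a group under componentwise composition. Comorphisms. A comorphism $f \colon \mathbb{G} \rightsquigarrow \mathbb{H}$ between small groupoids comprises a function $f \colon \mathbb{H}_0 \to \mathbb{G}_0$ together with, for each $u \in \mathbb{H}_0$, an assignment to each map $a \colon fu \to v$ of $\mathbb{G}$ of a map $f(a)_u \colon u \to \tilde f(a,u)$ of $\mathbb{H}$, such that: (i) $f(\tilde f(a,u)) = v$ for all $a \colon fu \to v$ in $\mathbb{G}$; (ii) $f(1_{fu})_u = 1_u$ for all $u \in \mathbb{H}_0$; (iii) $f(b)_{\tilde f(a,u)} \circ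 f(a)_u = f(b a)_u$ for all $a \colon fu \to v$ and $b \colon v \to w$ in $\mathbb{G}$. Comorphisms $f \colon \mathbb{G} \rightsquigarrow \mathbb{H}$ and $g \colon \mathbb{H} \rightsquigarrow \mathbb{K}$ compose by $(gf)(u) = f(g(u))$ on objects and $(gf)(a)_u = g\bigl(f(a)_{gu}\bigr)_u$ on maps, giving the category $\mathrm{Grpd}_{\mathrm{co}}$. For a bijective-on-objects functor $h \colon \mathbb{G} \to \mathbb{H}$, the comorphism $h_\ast \colon \mathbb{G} \rightsquigarrow \mathbb{H}$ acts on objects by the inverse of $h \colon \mathbb{G}_0 \to \mathbb{H}_0$, and sends $a \colon h_\ast(u) \to v$ in $\mathbb{G}$ to $h(a) \colon u \to h(v)$ in $\mathbb{H}$. Bisections. A bisection $\alpha$ of $\mathbb{G}$ is a family of maps $(\alpha_u \colon u \to \tilde\alpha(u))_{u \in \mathbb{G}_0}$ of $\mathbb{G}$ for which $\tilde\alpha \colon \mathbb{G}_0 \to \mathbb{G}_0$ is a bijection. The bisections form a group $\mathrm{Bis}(\mathbb{G})$ under $(\beta \cdot \alpha)_u = \beta_{\tilde\alpha(u)} \circ \alpha_u$. The conjugation automorphism $c_\alpha \colon \mathbb{G} \to \mathbb{G}$ is the functor acting as $\tilde\alpha$ on objects and sending a map $x \colon u \to v$ to $\alpha_v \circ x \circ \alpha_u^{-1} \colon \tilde\alpha(u) \to \tilde\alpha(v)$. Given a comorphism $f \colon \mathbb{G} \rightsquigarrow \mathbb{H}$, the pushforward bisection $f\alpha$ of $\mathbb{H}$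 is given by $(f\alpha)_u = f(\alpha_{fu})_u \colon u \to \tilde f(\alpha_{fu},u)$ for $u \in \mathbb{H}_0$. *)

(* Defs.v *)
From HB Require Import structures.
From mathcomp Require Import all_boot boolp.

Set Implicit Arguments.
Unset Strict Implicit.
Unset Printing Implicit Defensive.

(* Equality of maps, comorphisms, bisections, ... is Leibniz equality; by proof
   irrelevance and function extensionality it is equality of underlying data. *)

Declare Scope grpd_scope.
Delimit Scope grpd_scope with grpd.
Local Open Scope group_scope.
Local Open Scope grpd_scope.

Record category := Category {
  cob :> Type;
  chom : cob -> cob -> Type;
  cidm : forall X, chom X X;
  ccomp : forall X Y Z, chom Y Z -> chom X Y -> chom X Z;
  ccompA : forall X Y Z W (h : chom Z W) (g : chom Y Z) (f : chom X Y),
    ccomp h (ccomp g f) = ccomp (ccomp h g) f;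
  ccomp1m : forall X Y (f : chom X Y), ccomp (cidm Y) f = f;
  ccompm1 : forall X Y (f : chom X Y), ccomp f (cidm X) = f }.

Arguments cidm {c} X.

Definition is_iso (C : category) (X Y : C) (f : chom X Y) : Prop :=
  exists g : chom Y X, ccomp g f = cidm X /\ ccomp f g = cidm Y.

Record ext_inner (C : category) (G : C) := ExtInner {
  ei_map :> forall H : C, chom G H -> chom H H;
  ei_iso : forall (H : C) (f : chom G H), is_iso (ei_map f);
  ei_nat : forall (H K : C) (f : chom G H) (g : chom H K),
    ccomp g (ei_map f) = ccomp (ei_map (ccomp g f)) g }.

Section ExtInnerGroup.
Variables (C : category) (G : C).
Implicit Types b c : ext_inner G.

Lemma ext_inner_eq b c :
  (forall (H : C) (f : chom G H), b H f = c H f) -> b = c.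
Proof.
case: b c => [b bi bn] [c ci cn] /= bc.
have {}bc : b = c by apply: functional_extensionality_dep => H; apply: funext.
by subst c; congr ExtInner; apply: Prop_irrelevance.
Qed.

Lemma is_iso_id (X : C) : is_iso (cidm X).
Proof. by exists (cidm X); split; apply: ccomp1m. Qed.

Lemma is_iso_comp (X Y Z : C) (g : chom Y Z) (f : chom X Y) :
  is_iso g -> is_iso f -> is_iso (ccomp g f).
Proof.
move=> [g' [g'g gg']] [f' [f'f ff']]; exists (ccomp f' g').
split; first by rewrite -ccompA (ccompA g') g'g ccomp1m f'f.
by rewrite -ccompA (ccompA f) ff' ccomp1m gg'.
Qed.

Lemma ei_one_nat (H K : C) (f : chom G H) (g : chom H K) :
  ccomp g (cidm H) = ccomp (cidm K) g.
Proof. by rewrite ccomp1m ccompm1. Qed.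

Definition ei_one : ext_inner G :=
  ExtInner (fun H f => is_iso_id H) ei_one_nat.

Lemma ei_mul_nat b c (H K : C) (f : chom G H) (g : chom H K) :
  ccomp g (ccomp (b H f) (c H f)) =
  ccomp (ccomp (b K (ccomp g f)) (c K (ccomp g f))) g.
Proof. by rewrite ccompA (ei_nat b f g) -ccompA (ei_nat c f g) ccompA. Qed.

Definition ei_mul b c : ext_inner G :=
  ExtInner (fun H f => is_iso_comp (ei_iso b f) (ei_iso c f)) (@ei_mul_nat b c).

Definition ei_inv_map b (H : C) (f : chom G H) : chom H H :=
  sval (cid (ei_iso b f)).

Lemma ei_inv_mapl b (H : C) (f : chom G H) :
  ccomp (ei_inv_map b f) (b H f) = cidm H.
Proof. by rewrite /ei_inv_map; case: cid => ? []. Qed.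

Lemma ei_inv_mapr b (H : C) (f : chom G H) :
  ccomp (b H f) (ei_inv_map b f) = cidm H.
Proof. by rewrite /ei_inv_map; case: cid => ? []. Qed.

Lemma ei_inv_iso b (H : C) (f : chom G H) : is_iso (ei_inv_map b f).
Proof. by exists (b H f); split; rewrite ?ei_inv_mapl ?ei_inv_mapr. Qed.

Lemma ei_inv_nat b (H K : C) (f : chom G H) (g : chom H K) :
  ccomp g (ei_inv_map b f) = ccomp (ei_inv_map b (ccomp g f)) g.
Proof.
rewrite -[LHS]ccomp1m -(ei_inv_mapl b (ccomp g f)) -ccompA.
by rewrite (ccompA _ g) -ei_nat -(ccompA g) ei_inv_mapr ccompm1.
Qed.

Definition ei_inv b : ext_inner G := ExtInner (@ei_inv_iso b) (@ei_inv_nat b).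

Lemma ei_mulA : associative ei_mul.
Proof. by move=> a b c; apply: ext_inner_eq => H f /=; rewrite ccompA. Qed.
Lemma ei_1mul : left_id ei_one ei_mul.
Proof. by move=> a; apply: ext_inner_eq => H f /=; rewrite ccomp1m. Qed.
Lemma ei_mul1 : right_id ei_one ei_mul.
Proof. by move=> a; apply: ext_inner_eq => H f /=; rewrite ccompm1. Qed.
Lemma ei_Vmul : left_inverse ei_one ei_inv ei_mul.
Proof. by move=> a; apply: ext_inner_eq => H f /=; rewrite ei_inv_mapl. Qed.
Lemma ei_mulV : right_inverse ei_one ei_inv ei_mul.
Proof. by move=> a; apply: ext_inner_eq => H f /=; rewrite ei_inv_mapr. Qed.

HB.instance Definition _ := gen_eqMixin (ext_inner G).
HB.instance Definition _ := gen_choiceMixin (ext_inner G).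
HB.instance Definition _ :=
  isGroup.Build (ext_inner G) ei_mulA ei_1mul ei_mul1 ei_Vmul ei_mulV.

End ExtInnerGroup.

Record groupoid := Groupoid {
  ob :> Type;
  hom : ob -> ob -> Type;
  idm : forall u, hom u u;
  compm : forall u v w, hom v w -> hom u v -> hom u w;
  invm : forall u v, hom u v -> hom v u;
  compA : forall u v w x (c : hom w x) (b : hom v w) (a : hom u v),
    compm c (compm b a) = compm (compm c b) a;
  comp1m : forall u v (a : hom u v), compm (idm v) a = a;
  compm1 : forall u v (a : hom u v), compm a (idm u) = a;
  compVm : forall u v (a : hom u v), compm (invm a) a = idm u;
  compmV : forall u v (a : hom u v), compm a (invm a) = idm v }.

Arguments idm {g} u.

Notation "b ∘ a" := (compm b a) (at level 40, left associativity) : grpd_scope.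

(* Packing a map out of u with its codomain makes equations such as
   "f(1)_u = 1_u" well typed: equality in [star u] is equality of the codomains
   together with equality of the maps. *)
Definition star (G : groupoid) (u : G) : Type := {v : G & hom u v}.

Section Star.
Variable G : groupoid.

Definition tgt (u : G) (s : star u) : G := projT1 s.
Definition arr (u : G) (s : star u) : hom u (tgt s) := projT2 s.
Definition mkstar (u v : G) (a : hom u v) : star u := existT (hom u) v a.

Definition star_id (u : G) : star u := mkstar (idm u).
Definition star_comp (u : G) (s : star u) (t : star (tgt s)) : star u :=
  mkstar (arr t ∘ arr s).
Definition star_inv (u : G) (s : star u) : star (tgt s) := mkstar (invm (arr s)).

Definition star_cast (u u' : G) (e : u = u') (s : star u) : star u' :=
  eq_rect u (@star G) s u' e.

Lemma star_castE (u u' : G) (e : u = u') (s : star u) :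
  tgt (star_cast e s) = tgt s.
Proof. by case: _ / e. Qed.

Lemma star_cast_fam (s : forall u : G, star u) (u u' : G) (e : u = u') :
  star_cast e (s u) = s u'.
Proof. by case: _ / e. Qed.

Lemma star_cast_comp (u u' : G) (e : u = u') (s : star u) (t : star (tgt s)) :
  star_cast e (star_comp t) =
  star_comp (star_cast (esym (star_castE e s)) t).
Proof. by case: _ / e; rewrite (Prop_irrelevance (star_castE _ _) erefl). Qed.

Lemma star_compA (u : G) (s : star u) (t : star (tgt s)) (r : star (tgt t)) :
  star_comp (s := star_comp t) r = @star_comp u s (star_comp r).
Proof. by rewrite /star_comp /mkstar /= compA. Qed.

Lemma star_comp1 (u : G) (s : star u) : star_comp (star_id (tgt s)) = s.
Proof. by case: s => v a; rewrite /star_comp /mkstar /= comp1m. Qed.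

Lemma star_1comp (u : G) (s : star u) : @star_comp u (star_id u) s = s.
Proof. by case: s => v a; rewrite /star_comp /mkstar /= compm1. Qed.

Lemma star_compV (u : G) (s : star u) : star_comp (star_inv s) = star_id u.
Proof. by rewrite /star_comp /mkstar /= compVm. Qed.

End Star.

(* [como_lift f u] sends a : f u -> v to f(a)_u : u -> f~(a,u).  The cast in the
   last axiom retypes b : v -> w as a map out of f (f~(a,u)), which equals v by
   [como_tgt]. *)
Record comorphism (G H : groupoid) := Comorphism {
  como_ob :> H -> G;
  como_lift : forall u : H, star (como_ob u) -> star u;
  como_tgt : forall (u : H) (a : star (como_ob u)),
    como_ob (tgt (como_lift a)) = tgt a;
  como_id : forall u : H, como_lift (star_id (como_ob u)) = star_id u;
  como_comp : forall (u : H) (a : star (como_ob u)) (b : star (tgt a)),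
    como_lift (star_comp b) =
    star_comp (como_lift (star_cast (esym (como_tgt a)) b)) }.

Lemma comorphism_eq (G H : groupoid) (o : H -> G)
    (l : forall u : H, star (o u) -> star u) t i c t' i' c' :
  @Comorphism G H o l t i c = @Comorphism G H o l t' i' c'.
Proof.
have et : t = t' by apply: Prop_irrelevance.
by subst t'; congr Comorphism; apply: Prop_irrelevance.
Qed.

Program Definition como_idm (G : groupoid) : comorphism G G :=
  @Comorphism G G (fun u => u) (fun u a => a) _ _ _.

Section Comp.
Variables (G H K : groupoid) (g : comorphism H K) (f : comorphism G H).

Definition como_comp_lift (u : K) (a : star (f (g u))) : star u :=
  como_lift (como_lift a).

Lemma como_comp_tgt (u : K) (a : star (f (g u))) :
  f (g (tgt (como_comp_lift a))) = tgt a.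
Proof. by rewrite como_tgt como_tgt. Qed.

Lemma como_comp_id (u : K) : como_comp_lift (star_id (f (g u))) = star_id u.
Proof. by rewrite /como_comp_lift !como_id. Qed.

Lemma como_comp_comp (u : K) (a : star (f (g u))) (b : star (tgt a)) :
  como_comp_lift (star_comp b) =
  star_comp (como_comp_lift (star_cast (esym (como_comp_tgt a)) b)).
Proof.
rewrite /como_comp_lift !como_comp; congr star_comp; congr como_lift.
set e1 := esym (como_tgt a); set e2 := esym _; set e3 := esym _.
move: e1 e2 e3 => e1 e2 e3.
case: _ / e2 in e3 *.
by congr como_lift; congr star_cast.
Qed.

Definition como_compose : comorphism G K :=
  Comorphism como_comp_id como_comp_comp.

End Comp.

Definition Grpd_co : category.
Proof.
refine (@Category groupoid comorphism como_idm
  (fun G H K g f => como_compose g f) _ _ _).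
- by move=> *; apply: comorphism_eq.
- by move=> G H [o l t i c]; apply: comorphism_eq.
- by move=> G H [o l t i c]; apply: comorphism_eq.
Defined.

Section InverseFunction.
Variables (A B : Type) (h : A -> B) (hb : bijective h).

Lemma bij_preim (y : B) : exists x, h x = y.
Proof. by case: hb => g _ gK; exists (g y). Qed.

Definition inv_fun (y : B) : A := sval (cid (bij_preim y)).

Lemma inv_funK (y : B) : h (inv_fun y) = y.
Proof. exact: svalP (cid (bij_preim y)). Qed.

Lemma inv_fun_canc (x : A) : inv_fun (h x) = x.
Proof. by apply: (bij_inj hb); rewrite inv_funK. Qed.

End InverseFunction.

Record functor (G H : groupoid) := Functor {
  fun_ob :> G -> H;
  fun_map : forall u v : G, hom u v -> hom (fun_ob u) (fun_ob v);
  fun_id : forall u : G, fun_map (idm u) = idm (fun_ob u);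
  fun_comp : forall (u v w : G) (b : hom v w) (a : hom u v),
    fun_map (b ∘ a) = fun_map b ∘ fun_map a }.

Section LowerStar.
Variables (G H : groupoid) (h : functor G H) (hb : bijective h).

Definition fun_star (u : G) (a : star u) : star (h u) := mkstar (fun_map h (arr a)).

Lemma fun_star_cast (u u' : G) (w : H) (e : u = u') (e1 : h u = w)
    (e2 : h u' = w) (b : star u) :
  star_cast e1 (fun_star b) = star_cast e2 (fun_star (star_cast e b)).
Proof.
by case: _ / e in e2 *; congr star_cast; apply: Prop_irrelevance.
Qed.

(* h(a) has domain h (h_* u); the cast retypes it as a map out of u. *)
Definition lower_lift (u : H) (a : star (inv_fun hb u)) : star u :=
  star_cast (inv_funK hb u) (fun_star a).

Lemma lower_tgt (u : H) (a : star (inv_fun hb u)) :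
  inv_fun hb (tgt (lower_lift a)) = tgt a.
Proof. by rewrite star_castE inv_fun_canc. Qed.

Lemma lower_id (u : H) : lower_lift (star_id (inv_fun hb u)) = star_id u.
Proof.
rewrite /lower_lift /fun_star /= fun_id -/(star_id _).
exact: star_cast_fam.
Qed.

Lemma lower_comp (u : H) (a : star (inv_fun hb u)) (b : star (tgt a)) :
  lower_lift (star_comp b) =
  star_comp (lower_lift (star_cast (esym (lower_tgt a)) b)).
Proof.
rewrite /lower_lift /fun_star /= fun_comp.
rewrite -/(@star_comp _ _ (fun_star a) (fun_star b)) star_cast_comp.
congr star_comp; exact: fun_star_cast.
Qed.

Definition lower_star : comorphism G H := Comorphism lower_id lower_comp.

End LowerStar.

Record bisection (G : groupoid) := Bisection {
  bis_map :> forall u : G, star u;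
  bis_bij : bijective (fun u : G => tgt (bis_map u)) }.

Definition bis_ob (G : groupoid) (al : bisection G) (u : G) : G := tgt (al u).

Section BisectionGroup.
Variable G : groupoid.
Implicit Types al be : bisection G.

Lemma bisection_eq al be : (forall u : G, al u = be u) -> al = be.
Proof.
case: al be => [a ab] [b bb] /= e.
have {}e : a = b by apply: functional_extensionality_dep.
by subst b; congr Bisection; apply: Prop_irrelevance.
Qed.

Lemma bis_one_bij : bijective (fun u : G => tgt (star_id u)).
Proof. by exists (fun u => u). Qed.

Definition bis_one : bisection G := Bisection bis_one_bij.

Lemma bis_mul_bij be al :
  bijective (fun u : G => tgt (star_comp (be (bis_ob al u)))).
Proof. exact: (bij_comp (bis_bij be) (bis_bij al)). Qed.

Definition bis_mul be al : bisection G := Bisection (bis_mul_bij be al).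

(* (al^-1)_u is the inverse of the component of al with codomain u. *)
Definition bis_inv_map al (u : G) : star u :=
  star_cast (inv_funK (bis_bij al) u) (star_inv (al (inv_fun (bis_bij al) u))).

Lemma bis_inv_mapE al (u : G) :
  tgt (bis_inv_map al u) = inv_fun (bis_bij al) u.
Proof. by rewrite star_castE. Qed.

Lemma bis_inv_bij al : bijective (fun u : G => tgt (bis_inv_map al u)).
Proof.
exists (bis_ob al) => u; rewrite bis_inv_mapE; first exact: (inv_funK (bis_bij al)).
exact: (inv_fun_canc (bis_bij al)).
Qed.

Definition bis_inv al : bisection G := Bisection (bis_inv_bij al).

Lemma bis_mulA : associative bis_mul.
Proof. by move=> c b a; apply: bisection_eq => u /=; rewrite -star_compA. Qed.

Lemma bis_1mul : left_id bis_one bis_mul.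
Proof. by move=> a; apply: bisection_eq => u /=; rewrite star_comp1. Qed.

Lemma bis_mul1 : right_id bis_one bis_mul.
Proof. by move=> a; apply: bisection_eq => u /=; rewrite star_1comp. Qed.

Lemma bis_inv_map_ob al (u : G) : bis_inv_map al (tgt (al u)) = star_inv (al u).
Proof.
rewrite /bis_inv_map; move: (inv_funK _ _).
rewrite (inv_fun_canc (bis_bij al) u) => e.
by rewrite (Prop_irrelevance e erefl).
Qed.

Lemma bis_Vmul : left_inverse bis_one bis_inv bis_mul.
Proof.
move=> a; apply: bisection_eq => u /=.
by rewrite /bis_ob bis_inv_map_ob star_compV.
Qed.

Lemma bis_mulV : right_inverse bis_one bis_inv bis_mul.
Proof.
move=> a; rewrite -[LHS]bis_1mul -(bis_Vmul (bis_inv a)) -bis_mulA.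
by rewrite (bis_mulA (bis_inv a)) bis_Vmul bis_1mul.
Qed.

HB.instance Definition _ := gen_eqMixin (bisection G).
HB.instance Definition _ := gen_choiceMixin (bisection G).
HB.instance Definition _ :=
  isGroup.Build (bisection G) bis_mulA bis_1mul bis_mul1 bis_Vmul bis_mulV.

End BisectionGroup.

Section Conjugation.
Variables (G : groupoid) (al : bisection G).

Definition conj_map (u v : G) (x : hom u v) : hom (bis_ob al u) (bis_ob al v) :=
  arr (al v) ∘ x ∘ invm (arr (al u)).

Lemma conj_id (u : G) : conj_map (idm u) = idm (bis_ob al u).
Proof. by rewrite /conj_map compm1 compmV. Qed.

Lemma conj_comp (u v w : G) (b : hom v w) (a : hom u v) :
  conj_map (b ∘ a) = conj_map b ∘ conj_map a.
Proof.
rewrite /conj_map -!compA; congr (_ ∘ _); congr (_ ∘ _).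
by rewrite (compA (invm _) (arr _)) compVm comp1m.
Qed.

Definition conj_fun : functor G G := Functor conj_id conj_comp.

Lemma conj_bij : bijective conj_fun.
Proof. exact: bis_bij. Qed.

End Conjugation.

Section Pushforward.
Variables (G H : groupoid) (f : comorphism G H).
Implicit Types al be : bisection G.

Definition push_map al (u : H) : star u := como_lift (al (f u)).

Lemma push_map_mul be al (u : H) :
  push_map (bis_mul be al) u = star_comp (push_map be (tgt (push_map al u))).
Proof.
rewrite /push_map /= como_comp; congr star_comp; congr como_lift.
exact: star_cast_fam.
Qed.

Lemma push_map_one (u : H) : push_map (bis_one G) u = star_id u.
Proof. exact: como_id. Qed.

Lemma push_bij al : bijective (fun u : H => tgt (push_map al u)).
Proof.
exists (fun u : H => tgt (push_map (bis_inv al) u)) => u.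
  rewrite -[LHS]/(tgt (star_comp (push_map (bis_inv al) (tgt (push_map al u))))).
  by rewrite -push_map_mul bis_Vmul push_map_one.
rewrite -[LHS]/(tgt (star_comp (push_map al (tgt (push_map (bis_inv al) u))))).
by rewrite -push_map_mul bis_mulV push_map_one.
Qed.

Definition pushforward al : bisection H := Bisection (push_bij al).

End Pushforward.

(* Main.v *)
Require Import Defs.
From mathcomp Require Import all_boot.
From mathcomp Require Import boolp.

(** Why the theorem holds.

    A comorphism k : H ~> H equals (c_gamma)_* for a bisection gamma exactly when
    it sends gamma~(u) back to u and satisfies k(a)_{gamma~ u} o gamma_u =
    gamma_v o a for every a : u -> v ([conjugates]).  With this
    characterisation, the family (c_{f alpha})_* is an extended inner
    automorphism because comorphisms preserve composition of maps
    ([conjugates_nat]), and alpha |-> (c_{f alpha})_* is a homomorphism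
    because pushforward and conjugation both are.

    The inverse is a Yoneda argument.  The coslice of G at u, that is, the arrows
    out of u with exactly one map between any two of them, receives a comorphism
    from G.  An automorphism of this codiscrete groupoid is just a permutation
    of the arrows out of u, and alpha_u is defined as the arrow that b sends
    to 1_u at this comorphism ([inner_elt]).  It must then be shown that b is
    determined by alpha at every f : G ~> H.

    On objects, b_f sends the target of f(alpha_{f u})_u to u
    ([inner_at_push]).  In general no comorphism between H and the coslice of
    G at f u is available to compare b at the two, but the action groupoid P of
    f, with the objects of H and those maps of G that f lifts, lies over both:
    f factors as G ~> P ~> H with the identity on objects in the second
    factor, and the coslice of G at f u factors as
    G ~> P ~> coslice, where the object a of the coslice lies over the target of
    f(a)_u.  Naturality along the two maps out of P transports the definition of
    alpha from the coslice to H.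

    On maps, naturality of b along the coslice comorphism from H to the arrows out
    of u turns the value b_f(a) into the value of an object function, to which
    the previous formula applies ([inner_at_conj]). *)

Set Implicit Arguments.
Unset Strict Implicit.
Unset Printing Implicit Defensive.

Local Open Scope grpd_scope.

(** * Maps out of a fixed object *)

Section StarLemmas.
Variable G : groupoid.

Lemma mkstar_inj (u v : G) : injective (@mkstar G u v).
Proof.
move=> a b E; have := projT2_eq E.
by rewrite (Prop_irrelevance (projT1_eq E) erefl).
Qed.

Lemma star_comp_inj (u : G) (s : star u) (t t' : star (tgt s)) :
  star_comp t = star_comp t' -> t = t'.
Proof.
have K (r : star (tgt s)) : star_comp (s := star_inv s) (star_comp r) = r.
  by case: r => w b; rewrite /star_comp /mkstar /= -Defs.compA compmV compm1.
move=> E; rewrite -(K t) -(K t').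
exact: (congr1 (fun r : star u => @star_comp _ _ (star_inv s) r) E).
Qed.

Lemma star_cast_id (u : G) (e : u = u) (s : star u) : star_cast e s = s.
Proof. by rewrite (Prop_irrelevance e erefl). Qed.

Lemma star_cast_cast (u v w : G) (e1 : u = v) (e2 : v = w) (e : u = w)
    (s : star u) : star_cast e2 (star_cast e1 s) = star_cast e s.
Proof. by subst w; subst v; rewrite !star_cast_id. Qed.

(** Both factors of a composite change at once: the type of the second depends on
    the first, so the two equations cannot be rewritten one after the other. *)
Lemma star_comp_cast (u : G) (s s' : star u) (e : tgt s = tgt s')
    (t : star (tgt s)) (t' : star (tgt s')) :
  s' = s -> t' = star_cast e t -> star_comp t = star_comp t'.
Proof. by move=> ss ->; subst s'; rewrite star_cast_id. Qed.

End StarLemmas.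

(** * Lifting along a comorphism up to equality of objects *)

Section LiftAt.
Variables (G H : groupoid).
Implicit Types f g : comorphism G H.

(** The equation f u = x is a free argument, so that domains that agree only
    propositionally (such as f (tgt (lift a)) and tgt a) need no cast in
    statements; any two proofs give the same lift. *)
Definition lift_at f (u : H) (x : G) (e : f u = x) (a : star x) : star u :=
  como_lift (star_cast (esym e) a).

Lemma lift_at_refl f (u : H) (e : f u = f u) (a : star (f u)) :
  lift_at e a = como_lift a.
Proof. by rewrite (Prop_irrelevance e erefl). Qed.

Lemma lift_at_tgt f (u : H) (x : G) (e : f u = x) (a : star x) :
  f (tgt (lift_at e a)) = tgt a.
Proof. by case: _ / e in a *; rewrite como_tgt. Qed.

Lemma lift_at_comp f (u : H) (x : G) (e : f u = x) (a : star x)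
    (b : star (tgt a)) (e' : f (tgt (lift_at e a)) = tgt a) :
  lift_at e (star_comp b) = star_comp (lift_at e' b).
Proof.
case: _ / e in a b e' *; rewrite [LHS]como_comp /=.
by congr star_comp; congr como_lift; congr star_cast; apply: Prop_irrelevance.
Qed.

Lemma lift_at_fam f (s : forall x : G, star x) (u : H) (x : G) (e : f u = x) :
  lift_at e (s x) = como_lift (s (f u)).
Proof. by case: _ / e. Qed.

Lemma tgt_lift_at_ob f (u v : H) (e : f u = f v) (a : star (f v)) :
  u = v -> tgt (lift_at e a) = tgt (como_lift a).
Proof. by move=> uv; subst v; rewrite lift_at_refl. Qed.

Lemma comorphism_ext f g :
  (forall u : H, f u = g u) ->
  (forall (u : H) (x : G) (ef : f u = x) (eg : g u = x) (a : star x),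
     lift_at ef a = lift_at eg a) ->
  f = g.
Proof.
case: f g => [o l t i c] [o' l' t' i' c'] /= eo el.
have {eo} E : o = o' by apply: funext.
subst o'.
have El : l = l'.
  apply: functional_extensionality_dep => u; apply: funext => a.
  exact: (el u (o u) erefl erefl a).
by subst l'; apply: comorphism_eq.
Qed.

Lemma eq_lift_at f g (u : H) (x : G) (ef : f u = x) (eg : g u = x)
    (a : star x) : f = g -> lift_at ef a = lift_at eg a.
Proof. by move=> fg; subst g; rewrite (Prop_irrelevance ef eg). Qed.

End LiftAt.

Lemma lift_at_compose (G H K : groupoid) (g : comorphism H K)
    (f : comorphism G H) (u : K) (x : G) (y : H)
    (e : como_compose g f u = x) (eg : g u = y) (ef : f y = x) (a : star x) :
  lift_at e a = lift_at eg (lift_at ef a).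
Proof.
case: _ / eg in ef *; case: _ / ef in e a *.
by rewrite !lift_at_refl.
Qed.

Lemma is_iso_como_bij (G : groupoid) (k : comorphism G G) :
  @is_iso Grpd_co G G k -> bijective k.
Proof.
case=> k' [k'k kk'].
exists k' => u.
- exact: (congr1 (fun m : comorphism G G => m u) kk').
- exact: (congr1 (fun m : comorphism G G => m u) k'k).
Qed.

(** * Characterisation of conjugation comorphisms *)

Section Conjugates.

(** The object function of (c_gamma)_* is the inverse of that of gamma, so its
    lifts are most easily described at the objects gamma~(u), where no inverse
    function appears. *)
Definition conjugates (H : groupoid) (c : bisection H) (k : comorphism H H) :=
  (forall u : H, k (bis_ob c u) = u) /\
  (forall (u : H) (e : k (bis_ob c u) = u) (a : star u),
     star_comp (s := c u) (lift_at e a) = star_comp (c (tgt a))).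

Lemma lower_star_conj (H : groupoid) (c : bisection H) :
  conjugates c (lower_star (conj_bij c)).
Proof.
split=> [u|u e a]; first exact: (inv_fun_canc (conj_bij c)).
have E : lift_at e a = fun_star (conj_fun c) a.
  have gen : forall (w : H) (e1 : w = u) (e2 : conj_fun c w = bis_ob c u),
      star_cast e2 (fun_star (conj_fun c) (star_cast (esym e1) a))
      = fun_star (conj_fun c) a.
    by move=> w e1; subst w => e2; rewrite (Prop_irrelevance e2 erefl).
  exact: gen.
rewrite E; case: a {E} => v a.
by rewrite /star_comp /mkstar /= /conj_map -!Defs.compA compVm compm1.
Qed.

(** Every object has the form gamma~(u), and the lift k(a) is recovered by
    cancelling gamma_u in k(a) o gamma_u. *)
Lemma conjugates_uniq (H : groupoid) (c : bisection H) (k k' : comorphism H H) :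
  conjugates c k -> conjugates c k' -> k = k'.
Proof.
move=> [ko kl] [ko' kl'].
have surj (w : H) : exists u, bis_ob c u = w := bij_preim (bis_bij c) w.
apply: comorphism_ext => [w|w x e e' a].
  by have [u <-] := surj w; rewrite ko ko'.
have [u E] := surj w; subst w.
have xu : x = u by rewrite -e ko.
move: e e' a; rewrite xu => e e' a; apply: (@star_comp_inj _ u (c u)).
exact: etrans (kl u e a) (esym (kl' u e' a)).
Qed.

Lemma conjugates_one (H : groupoid) : conjugates (bis_one H) (como_idm H).
Proof.
split=> // u e a.
by rewrite lift_at_refl /= star_1comp star_comp1.
Qed.

Lemma conjugates_mul (H : groupoid) (c d : bisection H) (k l : comorphism H H) :
  conjugates c k -> conjugates d l ->
  conjugates (bis_mul c d) (como_compose k l).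
Proof.
move=> [ko kl] [lo ll].
split=> [u|u e a]; first by rewrite /= ko lo.
rewrite (lift_at_compose e (ko (bis_ob d u)) (lo u)).
rewrite [LHS]star_compA kl -star_compA -[RHS]star_compA.
exact: (congr1 (fun s : star u => star_comp (c (tgt s))) (ll u (lo u) a)).
Qed.

(** Both sides, evaluated at a and composed with (g gamma)_u = g(gamma_{g u}),
    give g(gamma_v o a): on one side g is applied to k(a) o gamma = gamma o a,
    on the other l conjugates the already lifted map g(a). *)
Lemma conjugates_nat (H K : groupoid) (g : comorphism H K) (c : bisection H)
    (k : comorphism H H) (l : comorphism K K) :
  conjugates c k -> conjugates (pushforward g c) l ->
  como_compose g k = como_compose l g.
Proof.
move=> [ko kl] [lo ll]; set d := pushforward g c in lo ll.
have surj (w : K) : exists u, bis_ob d u = w := bij_preim (bis_bij d) w.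
have gd (u : K) : g (bis_ob d u) = bis_ob c (g u) by exact: como_tgt.
apply: comorphism_ext => [w|w x e e' a].
  by have [u <-] := surj w; rewrite /= gd ko lo.
have [u E] := surj w; subst w.
have xu : x = g u by rewrite -e /= gd ko.
move: e e' a; rewrite xu => e e' a; apply: (@star_comp_inj _ u (d u)).
rewrite (lift_at_compose e (gd u) (ko (g u))).
rewrite (lift_at_compose e' (lo u) erefl) ll.
rewrite -(lift_at_comp (f := g) (e := erefl) (a := c (g u))) kl.
rewrite (lift_at_comp _ (lift_at_tgt erefl a)); congr star_comp.
exact: lift_at_fam.
Qed.

End Conjugates.

(** * From bisections to extended inner automorphisms *)

Section BisToInner.
Variable G : groupoid.
Implicit Types al be : bisection G.

Definition conj_family al (H : groupoid) (f : comorphism G H) : comorphism H H :=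
  lower_star (conj_bij (pushforward f al)).

Lemma pushforward_mul (H : groupoid) (f : comorphism G H) be al :
  pushforward f (bis_mul be al) = bis_mul (pushforward f be) (pushforward f al).
Proof. by apply: bisection_eq => u; apply: push_map_mul. Qed.

Lemma pushforward_one (H : groupoid) (f : comorphism G H) :
  pushforward f (bis_one G) = bis_one H.
Proof. by apply: bisection_eq => u; apply: push_map_one. Qed.

Lemma conj_family_mul be al (H : groupoid) (f : comorphism G H) :
  conj_family (bis_mul be al) f = como_compose (conj_family be f) (conj_family al f).
Proof.
apply: conjugates_uniq (lower_star_conj _) _; rewrite pushforward_mul.
by apply: conjugates_mul; apply: lower_star_conj.
Qed.

Lemma conj_family_one (H : groupoid) (f : comorphism G H) :
  conj_family (bis_one G) f = como_idm H.
Proof.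
apply: conjugates_uniq (lower_star_conj _) _; rewrite pushforward_one.
exact: conjugates_one.
Qed.

Lemma conj_family_iso al (H : Grpd_co) (f : chom (G : Grpd_co) H) :
  is_iso (conj_family al f : chom H H).
Proof.
exists (conj_family (bis_inv al) f); split.
- by rewrite -[LHS]conj_family_mul bis_Vmul conj_family_one.
- by rewrite -[LHS]conj_family_mul bis_mulV conj_family_one.
Qed.

Lemma conj_family_nat al (H K : Grpd_co) (f : chom (G : Grpd_co) H)
    (g : chom H K) :
  ccomp g (conj_family al f : chom H H) = ccomp (conj_family al (ccomp g f) : chom K K) g.
Proof.
apply: (@conjugates_nat H K g (pushforward f al)); first exact: lower_star_conj.
have -> : pushforward g (pushforward f al) = pushforward (ccomp g f : comorphism G K) al.
  exact: bisection_eq.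
exact: lower_star_conj.
Qed.

Definition inner_of_bis al : ext_inner (G : Grpd_co) :=
  ExtInner (@conj_family_iso al) (@conj_family_nat al).

End BisToInner.

(** * Actions of a groupoid as comorphisms to codiscrete groupoids *)

Section Codiscrete.
Variable X : Type.

Definition codisc : groupoid :=
  @Groupoid X (fun _ _ => unit) (fun _ => tt) (fun _ _ _ _ _ => tt)
    (fun _ _ _ => tt) (fun _ _ _ _ _ _ _ => erefl)
    (fun _ _ a => match a with tt => erefl end)
    (fun _ _ a => match a with tt => erefl end)
    (fun _ _ _ => erefl) (fun _ _ _ => erefl).

Lemma codisc_star_eq (x : codisc) (s t : star x) : tgt s = tgt t -> s = t.
Proof. by case: s t => [y []] [z []] /= yz; subst z. Qed.

(* An action of G on the fibres of p : X -> G amounts to a comorphism from G to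
   the codiscrete groupoid on X: a map out of x there is the same as an element
   of X. *)
Variables (G : groupoid) (p : X -> G) (act : forall x, star (p x) -> X).
Hypothesis act_tgt : forall x (a : star (p x)), p (act a) = tgt a.
Hypothesis act_id : forall x, act (star_id (p x)) = x.
Hypothesis act_comp : forall x (a : star (p x)) (b : star (tgt a)),
  act (star_comp b) = act (star_cast (esym (act_tgt a)) b).

Definition act_lift (x : codisc) (a : star (p x)) : star x :=
  @mkstar codisc x (act a) tt.

Lemma act_lift_id (x : codisc) : act_lift (star_id (p x)) = star_id x.
Proof. by apply: codisc_star_eq; apply: act_id. Qed.

Lemma act_lift_comp (x : codisc) (a : star (p x)) (b : star (tgt a)) :
  act_lift (star_comp b) =
  @star_comp _ _ (act_lift a) (@act_lift (act a) (star_cast (esym (act_tgt a)) b)).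
Proof. by apply: codisc_star_eq; apply: act_comp. Qed.

Definition action_como : comorphism G codisc :=
  @Comorphism G codisc p act_lift act_tgt act_lift_id act_lift_comp.

End Codiscrete.

Section Coslice.
Variables (G : groupoid) (u : G).

(** The left action of G on the maps out of u.  It is used in two ways: at G, to
    extract a bisection, and at the target H of a comorphism, where it is
    faithful and so detects maps of H. *)
Definition coslice : comorphism G (codisc (star u)) :=
  @action_como (star u) G (@tgt G u) (fun s t => star_comp t)
    (fun _ _ => erefl) (fun s => star_comp1 s)
    (fun s t r => esym (star_compA r)).

End Coslice.

(** * The action groupoid of a comorphism *)

Section ActionGroupoid.
Variables (G H : groupoid) (f : comorphism G H).

(** Requiring the codomain of the map of G to be f v on the nose, rather than
    taking an arbitrary map out of f u whose lift ends at v, makes composition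
    that of G, with no cast. *)
Definition act_hom (u v : H) : Type :=
  {a : hom (f u) (f v) | tgt (como_lift (mkstar a)) = v}.

Lemma act_hom_eq (u v : H) (a b : act_hom u v) : sval a = sval b -> a = b.
Proof. by case: a b => [a ea] [b eb] /= ab; subst b; congr exist. Qed.

Lemma act_hom_id (u : H) : tgt (como_lift (mkstar (idm (f u)))) = u.
Proof. by rewrite -/(star_id _) como_id. Qed.

Lemma act_hom_comp (u v w : H) (b : act_hom v w) (a : act_hom u v) :
  tgt (como_lift (mkstar (sval b ∘ sval a))) = w.
Proof.
case: a b => [a ea] [b eb] /=.
rewrite -/(@star_comp _ _ (mkstar a) (mkstar b)) como_comp.
by rewrite -[RHS]eb -(tgt_lift_at_ob (como_tgt (mkstar a)) (mkstar b) ea).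
Qed.

Lemma act_hom_inv (u v : H) (a : act_hom u v) :
  tgt (como_lift (mkstar (invm (sval a)))) = u.
Proof.
case: a => a ea /=.
rewrite -(tgt_lift_at_ob (como_tgt (mkstar a)) (mkstar (invm a)) ea).
have := como_comp (star_inv (mkstar a)).
rewrite star_compV como_id => E.
exact: (congr1 (@tgt _ _) (esym E)).
Qed.

Definition act_grpd : groupoid.
Proof.
refine (@Groupoid H act_hom (fun u => exist _ _ (act_hom_id u))
  (fun u v w b a => exist _ _ (act_hom_comp b a))
  (fun u v a => exist _ _ (act_hom_inv a)) _ _ _ _ _).
- by move=> *; apply: act_hom_eq; apply: Defs.compA.
- by move=> u v a; apply: act_hom_eq; apply: comp1m.
- by move=> u v a; apply: act_hom_eq; apply: compm1.
- by move=> u v a; apply: act_hom_eq; apply: compVm.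
- by move=> u v a; apply: act_hom_eq; apply: compmV.
Defined.

(** The projection to G is a discrete opfibration: [act_under] and [act_over]
    are the two directions of the bijection between maps out of u in the action
    groupoid and maps out of f u in G. *)
Definition act_under (u : act_grpd) (s : star u) : star (f u) :=
  mkstar (sval (arr s)).

Lemma act_under_lift (u : act_grpd) (s : star u) :
  tgt (como_lift (act_under s)) = tgt s.
Proof. exact: (svalP (arr s)). Qed.

Lemma act_under_inj (u : act_grpd) : injective (@act_under u).
Proof.
move=> s t E.
have := act_under_lift s; rewrite E act_under_lift.
case: s t E => [v [a ea]] [w [b eb]] E /= vw.
subst w; rewrite /act_under /mkstar /= in E.
have ab : a = b by exact: mkstar_inj E.
by subst b; rewrite (Prop_irrelevance ea eb).
Qed.

Lemma act_under_cast (u v : act_grpd) (e : u = v) (e' : f u = f v) (s : star u) :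
  act_under (star_cast e s) = star_cast e' (act_under s).
Proof. by subst v; rewrite !star_cast_id. Qed.

(** A map out of f u becomes a map of the action groupoid only once its codomain
    is replaced by the propositionally equal f (tgt (lift s)); this is the one
    place where the arrow itself, not its domain, is retyped. *)
Lemma act_over_sig (u : H) (s : star (f u)) :
  {a : hom (f u) (f (tgt (como_lift s))) | mkstar a = s}.
Proof.
have : f (tgt (como_lift s)) = tgt s by exact: como_tgt.
move: (f _) => w e; subst w.
by exists (arr s); case: s.
Qed.

Lemma act_over_proof (u : H) (s : star (f u)) :
  tgt (como_lift (mkstar (sval (act_over_sig s)))) = tgt (como_lift s).
Proof. by rewrite (svalP (act_over_sig s)). Qed.

Definition act_over (u : act_grpd) (s : star (f u)) : star u :=
  @mkstar act_grpd u (tgt (como_lift s)) (exist _ _ (act_over_proof s)).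

Lemma act_overK (u : act_grpd) (s : star (f u)) : act_under (act_over s) = s.
Proof. exact: (svalP (act_over_sig s)). Qed.

Lemma act_over_tgt (u : act_grpd) (s : star (f u)) : f (tgt (act_over s)) = tgt s.
Proof. exact: como_tgt. Qed.

Lemma act_over_id (u : act_grpd) : act_over (star_id (f u)) = star_id u.
Proof. by apply: act_under_inj; rewrite act_overK. Qed.

Lemma act_over_comp (u : act_grpd) (a : star (f u)) (b : star (tgt a)) :
  act_over (star_comp b) =
  star_comp (act_over (star_cast (esym (act_over_tgt a)) b)).
Proof.
apply: act_under_inj; rewrite act_overK.
set t := act_over (star_cast _ _).
have -> : act_under (star_comp t) = @star_comp G (f u) (act_under (act_over a)) (act_under t).
  by [].
by apply: star_comp_cast (act_overK _) (act_overK _).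
Qed.

Definition act_proj : comorphism G act_grpd :=
  @Comorphism G act_grpd f act_over act_over_tgt act_over_id act_over_comp.

Definition act_eval_lift (u : H) (s : @star act_grpd u) : star u :=
  como_lift (act_under s).

Lemma act_eval_id (u : H) : act_eval_lift (@star_id act_grpd u) = star_id u.
Proof. exact: como_id. Qed.

Lemma act_eval_comp (u : H) (a : @star act_grpd u) (b : star (tgt a)) :
  act_eval_lift (star_comp b) =
  star_comp (act_eval_lift (@star_cast act_grpd _ _ (esym (act_under_lift a)) b)).
Proof.
rewrite /act_eval_lift.
rewrite [LHS](como_comp (c := f) (a := act_under a) (act_under b)).
congr star_comp; congr como_lift; apply: esym; exact: act_under_cast.
Qed.

(** The functor from the action groupoid to H that sends a to its lift is the
    identity on objects; this is the comorphism that it induces. *)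
Definition act_eval : comorphism act_grpd H :=
  @Comorphism act_grpd H (fun u => u) act_eval_lift act_under_lift act_eval_id
    act_eval_comp.

Lemma act_factor : como_compose act_eval act_proj = f.
Proof.
apply: comorphism_ext => // u x ef eg a.
rewrite (lift_at_compose ef erefl ef) lift_at_refl.
by rewrite /= /act_eval_lift [X in como_lift X]act_overK; congr como_lift; congr star_cast;
  apply: Prop_irrelevance.
Qed.

(* The action groupoid acts on the maps out of f u in G, placed over H by the
   targets of their lifts at u. *)
Section TransportOfCoslice.
Variable u : H.

Definition tr_ob (x : star (f u)) : act_grpd := tgt (como_lift x).

Definition tr_act (x : star (f u)) (s : star (tr_ob x)) : star (f u) :=
  star_comp (star_cast (como_tgt x) (act_under s)).

Lemma tr_act_tgt (x : star (f u)) (s : star (tr_ob x)) : tr_ob (tr_act s) = tgt s.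
Proof.
rewrite /tr_ob /tr_act como_comp /= (star_cast_cast _ _ erefl).
exact: act_under_lift.
Qed.

Lemma tr_act_id (x : star (f u)) : tr_act (star_id (tr_ob x)) = x.
Proof.
by rewrite /tr_act -[RHS]star_comp1; congr star_comp; apply: star_cast_fam.
Qed.

Lemma tr_act_comp (x : star (f u)) (a : star (tr_ob x)) (b : star (tgt a)) :
  tr_act (star_comp b) = tr_act (star_cast (esym (tr_act_tgt a)) b).
Proof.
rewrite /tr_act.
rewrite (star_cast_comp (como_tgt x) (s := act_under a) (act_under b)).
rewrite -star_compA; congr star_comp.
have e : f (tgt a) = f (tr_ob (tr_act a)) by rewrite tr_act_tgt.
rewrite (act_under_cast _ e); apply: esym; exact: star_cast_cast.
Qed.

Definition transport_coslice : comorphism act_grpd (codisc (star (f u))) :=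
  action_como tr_act_id tr_act_comp.

Lemma transport_coslice_proj :
  como_compose transport_coslice act_proj = coslice (f u).
Proof.
apply: comorphism_ext => [x|x v ef eg a]; first exact: como_tgt.
apply: codisc_star_eq.
rewrite (lift_at_compose ef erefl ef) lift_at_refl.
case: _ / eg in a ef *; rewrite lift_at_refl /= /tr_act.
rewrite [X in star_cast _ X]act_overK.
by rewrite (star_cast_cast _ _ erefl).
Qed.

End TransportOfCoslice.

End ActionGroupoid.

(** * From extended inner automorphisms to bisections *)

Section InnerToBis.
Variables (G : groupoid) (b : ext_inner (G : Grpd_co)).

(** The components of b with the comorphism types restored, which the coercion
    from the category of groupoids hides. *)
Definition inner_at (H : groupoid) (f : comorphism G H) : comorphism H H := b H f.

Lemma inner_at_bij (H : groupoid) (f : comorphism G H) : bijective (inner_at f).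
Proof. exact: is_iso_como_bij (ei_iso b f). Qed.

Lemma inner_at_nat (H K : groupoid) (f : comorphism G H) (g : comorphism H K) :
  como_compose g (inner_at f) = como_compose (inner_at (como_compose g f)) g.
Proof. exact: (ei_nat b f g). Qed.

Lemma inner_at_ob (H K : groupoid) (f : comorphism G H) (g : comorphism H K)
    (u : K) :
  inner_at f (g u) = g (inner_at (como_compose g f) u).
Proof. exact: (congr1 (fun m : comorphism H K => m u) (inner_at_nat f g)). Qed.

(** A preimage of the identity, because conjugation acts on objects through the
    inverse: the value of (c_{f alpha})_* at alpha_u is 1_u. *)
Definition inner_elt (u : G) : star u :=
  inv_fun (inner_at_bij (coslice u)) (star_id u).

Lemma inner_eltK (u : G) : inner_at (coslice u) (inner_elt u) = star_id u.
Proof. exact: inv_funK. Qed.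

(** Naturality along P ~> H and P ~> coslice, for P the action groupoid of f,
    reduces this to the defining property of [inner_elt]; the identity of f u,
    seen as an object of the coslice, lies over u. *)
Lemma inner_at_push (H : groupoid) (f : comorphism G H) (u : H) :
  inner_at f (tgt (como_lift (inner_elt (f u)))) = u.
Proof.
(* [act_eval f] is the identity on objects, so its argument is the object of H. *)
have E := inner_at_ob (act_proj f) (act_eval f) (tgt (como_lift (inner_elt (f u)))).
rewrite act_factor in E.
rewrite -[LHS]E.
rewrite -[X in inner_at _ X]/(transport_coslice f u (inner_elt (f u))).
rewrite inner_at_ob transport_coslice_proj inner_eltK /=.
by rewrite /tr_ob como_id.
Qed.

(** By [inner_at_push] at the identity, the object function is a section of the
    bijection given by the component of b at the identity, hence its inverse. *)
Lemma inner_elt_bij : bijective (fun u : G => tgt (inner_elt u)).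
Proof.
have [k kK Kk] := inner_at_bij (como_idm G).
have E u : tgt (inner_elt u) = k u.
  by apply: (can_inj kK); rewrite Kk; apply: (inner_at_push (como_idm G)).
exists (inner_at (como_idm G)) => u; rewrite E; first exact: Kk.
exact: kK.
Qed.

Definition bis_of_inner : bisection G := Bisection inner_elt_bij.

(** The coslice comorphism g : H ~> star u is faithful on maps, and the component l
    of b at g f is determined by its objects since any two parallel maps of the
    codiscrete groupoid agree.  So the equation g o b_f = l o g, evaluated at
    the object d_u of star u, computes b_f(a). *)
Lemma inner_at_conj (H : groupoid) (f : comorphism G H) :
  conjugates (pushforward f bis_of_inner) (inner_at f).
Proof.
split=> [u|u e a]; first exact: inner_at_push.
set d := pushforward f bis_of_inner in e *.
set g := coslice u; set l := inner_at (como_compose g f).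
have lP (x : star u) : l (star_comp (d (tgt x))) = x.
  exact: (inner_at_push (como_compose g f) x).
have l1 : l (d u) = star_id u by rewrite -[in LHS](star_1comp (d u)); apply: lP.
have e1 : como_compose g (inner_at f) (d u) = u by exact: e.
have e2 : como_compose l g (d u) = u by rewrite /= l1.
(* The two composites are objects of the coslice; l is injective on objects. *)
apply: (bij_inj (inner_at_bij (como_compose g f))); rewrite -/l lP.
have := eq_lift_at e1 e2 a (inner_at_nat f g).
rewrite (lift_at_compose (y := bis_ob d u) e1 erefl e).
rewrite (lift_at_compose (y := star_id u : codisc (star u)) e2 l1 erefl).
move=> /(congr1 (@tgt _ _)) E.
have {}E : star_comp (lift_at e a) = tgt (lift_at l1 (como_lift (c := g) (u := star_id u : codisc (star u)) a)).
  exact: E.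
rewrite E lift_at_tgt.
exact: star_1comp.
Qed.

Lemma inner_of_bisK : inner_of_bis bis_of_inner = b.
Proof.
apply: ext_inner_eq => H f.
exact: conjugates_uniq (lower_star_conj _) (inner_at_conj f).
Qed.

End InnerToBis.

Lemma bis_of_innerK (G : groupoid) (al : bisection G) :
  bis_of_inner (inner_of_bis al) = al.
Proof.
apply: bisection_eq => u.
apply: (bij_inj (inner_at_bij (inner_of_bis al) (coslice u))).
rewrite [LHS]inner_eltK.
have [ko _] := lower_star_conj (pushforward (coslice u) al).
have <- : bis_ob (pushforward (coslice u) al) (star_id u) = al u.
  exact: star_1comp.
exact: esym (ko (star_id u)).
Qed.

Theorem theorem12 (G : groupoid) :
  exists phi : bisection G -> ext_inner (G : Grpd_co),
    [/\ {morph phi : be al / (be * al)%g >-> (be * al)%g},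
        bijective phi
      & forall (al : bisection G) (H : groupoid) (f : comorphism G H),
          phi al H f = lower_star (conj_bij (pushforward f al))].
Proof.
exists (@inner_of_bis G); split=> //.
- by move=> be al; apply: ext_inner_eq => H f; apply: conj_family_mul.
- by exists (@bis_of_inner G) => [al|b]; [apply: bis_of_innerK|apply: inner_of_bisK].
Qed.
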